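(* There exist no Darboux coordinates on $(\mathbb{S}^6,\omega)$; that is, there is no point $p\in\mathbb{S}^6$ near which $(\mathbb{S}^6,\omega)$ has Darboux coordinates.
   Context: The octonions $\mathbb{O}$ are the real algebra with vector space basis $e_0,e_1,\dots,e_7$, unit $e_0=1$, and products $e_ie_j=-\delta_{ij}+\sum_{k=1}^7\epsilon_{ijk}e_k$ for $i,j\in\{1,\dots,7\}$, where $\epsilon_{ijk}$ is completely antisymmetric, equal to $1$ for $ijk=123,145,167,246,275,374,365$, and $0$ whenever $(i,j,k)$ is not a permutation of one of these triples. The imaginary octonions (span of $e_1,\dots,e_7$) are identified with $\mathbb{R}^7$ with its standard scalar product $\langle\cdot,\cdot\rangle$. The cross product on $\mathbb{R}^7$ is $u\times v:=\frac12(u\cdot v-v\cdot u)$. The constant-coefficient $3$-form $\widetilde\omega$ on $\mathbb{R}^7$ is $\widetilde\omega(u,v,w)=\langle u\times v,w\rangle$. Let $j:\mathbb{S}^6\hookrightarrow\mathbb{R}^7$ be the inclusion of the unit sphere and $\omega:=j^*\widetilde\omega\in\Omega^3(\mathbb{S}^6)$. An $n$-plectic manifold is a manifold with a closed $(n+1)$-form $\eta$ such that $\iota_v\eta=0$ for a tangent vector $v$ implies $v=0$; $(\mathbb{S}^6,\omega)$ is $2$-plectic. A $k$-plectic manifold $(M,\omega)$ of dimension $n$ has Darboux coordinates near $p\in M$ if there is a neighbourhood $U$ of $p$ with coordinates $u^1,\dots,u^n$ and constants $a_{i_1,\dots,i_{k+1}}\in\mathbb{R}$ such that $\omega|_U=\sum_{1\le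 i_1<\dots<i_{k+1}\le n}a_{i_1,\dots,i_{k+1}}\,du^{i_1}\wedge\dots\wedge du^{i_{k+1}}$. *)

(* Defs.v *)
From HB Require Import structures.
From mathcomp Require Import all_boot all_order all_algebra.
From mathcomp Require Import all_classical all_reals all_analysis.

Set Implicit Arguments.
Unset Strict Implicit.
Unset Printing Implicit Defensive.

Import Order.TTheory GRing.Theory Num.Theory.
Import numFieldNormedType.Exports.

Local Open Scope classical_set_scope.
Local Open Scope ring_scope.

Definition dot (R : realType) (n : nat) (u v : 'rV[R]_n) : R :=
  \sum_(i < n) u 0 i * v 0 i.

(** * Octonions and the cross product of R^7 *)

Definition fano_triples : seq (seq nat) :=
  [:: [:: 1; 2; 3]; [:: 1; 4; 5]; [:: 1; 6; 7]; [:: 2; 4; 6];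
      [:: 2; 7; 5]; [:: 3; 7; 4]; [:: 3; 6; 5]]%N.

(* The even permutations of a triple are its three rotations; swapping two
   entries gives the odd ones. *)
Definition eps (R : realType) (i j k : nat) : R :=
  let even_perms := flatten [seq [:: t; rot 1 t; rot 2 t] | t <- fano_triples] in
  if [:: i; j; k] \in even_perms then 1
  else if [:: j; i; k] \in even_perms then -1
  else 0.

(* An octonion is the row of its coordinates along e_0, ..., e_7. *)
Definition oct_e (R : realType) (i : 'I_8) : 'rV[R]_8 := delta_mx 0 i.

Definition oct_mul_basis (R : realType) (i j : 'I_8) : 'rV[R]_8 :=
  if i == 0 then oct_e R j
  else if j == 0 then oct_e R i
  else - ((i == j)%:R *: oct_e R 0)
       + \sum_(k < 8 | k != 0) eps R i j k *: oct_e R k.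

Definition oct_mul (R : realType) (x y : 'rV[R]_8) : 'rV[R]_8 :=
  \sum_(i < 8) \sum_(j < 8) (x 0 i * y 0 j) *: oct_mul_basis R i j.

(* R^7 is identified with the imaginary octonions: coordinate [i : 'I_7] of a
   vector is its coordinate along e_(i+1). *)
Definition oct_of_im (R : realType) (u : 'rV[R]_7) : 'rV[R]_8 :=
  row_mx (0 : 'rV[R]_1) u.

Definition im_of_oct (R : realType) (x : 'rV[R]_8) : 'rV[R]_7 :=
  @rsubmx R 1 1 7 x.

Definition cross (R : realType) (u v : 'rV[R]_7) : 'rV[R]_7 :=
  im_of_oct (2^-1 *: (oct_mul (oct_of_im u) (oct_of_im v)
                      - oct_mul (oct_of_im v) (oct_of_im u))).

(** * Smooth maps, also on subsets that need not be open *)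

Fixpoint Ck (R : realType) (V W : normedModType R) (k : nat)
    (A : set V) (f : V -> W) : Prop :=
  match k with
  | 0%N => forall x, A x -> {for x, continuous f}
  | k'.+1 => (forall x, A x -> differentiable f x) /\
             forall v : V, Ck k' A ('D_v f)
  end.

Definition smooth (R : realType) (V W : normedModType R)
    (A : set V) (f : V -> W) : Prop := forall k : nat, Ck k A f.

Definition smooth_extension (R : realType) (V W : normedModType R)
    (S : set V) (f : V -> W) (x : V) (g : V -> W) : Prop :=
  exists A : set V,
    [/\ open A, A x, smooth A g & forall y, A y -> S y -> g y = f y].

Definition smooth_on (R : realType) (V W : normedModType R)
    (S : set V) (f : V -> W) : Prop :=
  forall x, S x -> exists g, smooth_extension S f x g.

(* The differential at [x] of a map [f] that is smooth on [S], computed from an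
   arbitrary local smooth extension.  It is only meaningful on the vectors
   tangent to [S] at [x], where it does not depend on the extension. *)
Definition diff_on (R : realType) (V W : normedModType R)
    (S : set V) (f : V -> W) (x : V) : V -> W :=
  'd (xget f [set g | smooth_extension S f x g]) x.

(** * Charts of the unit sphere *)

Definition sphere (R : realType) (n : nat) : set 'rV[R]_n.+1 :=
  [set x | dot x x = 1].

Definition tangent_sphere (R : realType) (n : nat) (x : 'rV[R]_n.+1) :
    set 'rV[R]_n.+1 := [set v | dot x v = 0].

(* [u] restricts to a diffeomorphism from [U], open in the sphere, onto an open
   subset of R^n. *)
Definition sphere_chart (R : realType) (n : nat) (U : set 'rV[R]_n.+1)
    (u : 'rV[R]_n.+1 -> 'rV[R]_n) : Prop :=
  [/\ exists2 A : set 'rV[R]_n.+1, open A & U = A `&` @sphere R n,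
      open (u @` U),
      smooth_on U u &
      exists2 phi : 'rV[R]_n -> 'rV[R]_n.+1,
        smooth (u @` U) phi & forall x, U x -> phi (u x) = x].

(** * Differential forms and Darboux coordinates *)

(* [eta x v] is the value at the point [x] on the vectors [v 0, ..., v (k-1)]. *)
Definition kform (R : realType) (n k : nat) : Type :=
  'rV[R]_n -> ('I_k -> 'rV[R]_n) -> R.

Definition strictly_increasing (n k : nat) (I : {ffun 'I_k -> 'I_n}) : bool :=
  [forall b : 'I_k, forall c : 'I_k, (b < c)%N ==> (I b < I c)%N].

(* (du^(i_1) /\ ... /\ du^(i_k))_x (v_1, ..., v_k) = det (du^(i_b)_x (v_c)). *)
Definition wedge_du (R : realType) (n k : nat) (U : set 'rV[R]_n.+1)
    (u : 'rV[R]_n.+1 -> 'rV[R]_n) (I : {ffun 'I_k -> 'I_n}) : kform R n.+1 k :=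
  fun x v => \det (\matrix_(b < k, c < k) diff_on U u x (v c) 0 (I b)).

(* Equality of forms on the sphere is tested on tangent vectors only, so a form
   [eta] of the ambient space stands here for its pullback along the inclusion
   of the sphere. *)
Definition has_darboux_coordinates_near (R : realType) (n k : nat)
    (eta : kform R n.+1 k) (p : 'rV[R]_n.+1) : Prop :=
  exists (U : set 'rV[R]_n.+1) (u : 'rV[R]_n.+1 -> 'rV[R]_n)
         (a : {ffun 'I_k -> 'I_n} -> R),
    [/\ U p, sphere_chart U u &
        forall (x : 'rV[R]_n.+1) (v : 'I_k -> 'rV[R]_n.+1),
          U x -> (forall c, tangent_sphere x (v c)) ->
          eta x v = \sum_(I : {ffun 'I_k -> 'I_n} | strictly_increasing I)
                      a I * wedge_du U u I x v].

Definition omega_tilde (R : realType) (u v w : 'rV[R]_7) : R :=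
  dot (cross u v) w.

(* The differential of the inclusion S^6 -> R^7 is the inclusion of tangent
   spaces, so the pullback of omega_tilde is given by the same formula. *)
Definition omega (R : realType) : kform R 7 3 :=
  fun _ v => omega_tilde (v 0) (v 1) (v 2).

(* Main.v *)
Require Import Defs.
From mathcomp Require Import all_boot all_order all_algebra.
From mathcomp Require Import all_classical all_reals all_analysis.
From mathcomp Require Import ring lra.

(** The form omega determines, up to sign, the almost complex structure
    J x = cross p x on the tangent space at each point [p] of the sphere.  If omega
    had constant coefficients in some coordinates, so would J, which would then be
    integrable; but this almost complex structure of the six-sphere is not.  The
    proof below is this argument, stripped to one explicit identity between second
    derivatives.

    Let phi be the inverse of a Darboux chart.  For constant vectors X, Z, W of the
    coordinate space, omega(D_X phi, D_Z phi, D_W phi) is a constant function.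
    Fix [p] = phi q.  Since D phi maps onto the tangent space at [p]
    ([tangent_parametrization_surj]), the second derivatives at q define a map
    [B] on pairs of tangent vectors, B (D_X phi) (D_M phi) = D_M (D_X phi), with
    three properties.
    - It is symmetric ([derive_derive_sym]).
    - <p, B x m> = - <x, m>, by differentiating <phi, D_X phi> = 0.
    - omega(B x m, z, w) + omega(x, B z m, w) + omega(x, z, B w m) = 0, by
      differentiating the constant function above in the direction M.
    Only values at the single point [p] are involved, and there the three
    properties contradict each other ([no_symmetric_second_derivative]): for
    nonzero tangent [x] and [y] with [y] orthogonal to [x] and J x, a sum of four instances
    of the third property reads - 4 |x|^2 |y|^2 = 0.  The cancellations in that sum
    use two facts about the cross product: its triple product is cyclic
    ([dot_cross_cycle]), and it satisfies the polarized form of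
    cross u (cross u v) = <u, v> u - <u, u> v ([cross_cross]). *)

Set Implicit Arguments.
Unset Strict Implicit.
Unset Printing Implicit Defensive.

Import Order.TTheory GRing.Theory Num.Theory.
Import numFieldNormedType.Exports.

Local Open Scope classical_set_scope.
Local Open Scope ring_scope.

(** * Coordinates of the cross product *)

(** Integer copy of the structure constants: over an abstract real field they
    do not compute, over the integers they do. *)
Definition eps_int (i j k : nat) : int :=
  let even_perms := flatten [seq [:: t; rot 1 t; rot 2 t] | t <- fano_triples] in
  if [:: i; j; k] \in even_perms then 1
  else if [:: j; i; k] \in even_perms then -1
  else 0.

Lemma epsE (R : realType) i j k : eps R i j k = (eps_int i j k)%:~R.
Proof.
rewrite /eps /eps_int.
by do 2?case: ifP => _; rewrite ?rmorphN ?rmorph1 ?rmorph0.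
Qed.

Lemma eps_int_swap i j k : (0 < i < 8)%N -> (0 < j < 8)%N -> (0 < k < 8)%N ->
   eps_int j i k = - eps_int i j k.
Proof.
have swap : all (fun i => all (fun j => all (fun k => eps_int j i k == - eps_int i j k)
   (iota 1 7)) (iota 1 7)) (iota 1 7) by vm_compute.
move=> hi hj hk.
move/allP: swap => /(_ i); rewrite mem_iota => /(_ hi).
move/allP => /(_ j); rewrite mem_iota => /(_ hj).
move/allP => /(_ k); rewrite mem_iota => /(_ hk).
by move/eqP.
Qed.

Lemma oct_of_im0 (R : realType) (u : 'rV[R]_7) : oct_of_im u 0 ord0 = 0.
Proof.
rewrite /oct_of_im (_ : ord0 = lshift 7 (0 : 'I_1)); last exact/val_inj.
by rewrite (@row_mxEl _ 1 1 7) mxE.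
Qed.

Lemma oct_of_imS (R : realType) (u : 'rV[R]_7) i :
  oct_of_im u 0 (lift ord0 i) = u 0 i.
Proof.
rewrite /oct_of_im (_ : lift ord0 i = rshift 1 i); last exact/val_inj.
by rewrite (@row_mxEr _ 1 1 7).
Qed.

(** The half commutator of two imaginary octonions has structure constants
    [eps]: the real part of the product is symmetric and drops out, the
    imaginary part is antisymmetric. *)
Lemma crossE (R : realType) (u v : 'rV[R]_7) (k : 'I_7) :
  cross u v 0 k = \sum_(i < 7) \sum_(j < 7)
    (eps_int i.+1 j.+1 k.+1)%:~R * (u 0 i * v 0 j).
Proof.
rewrite /cross /im_of_oct mxE mxE mxE.
have imE (x y : 'rV[R]_7) : (oct_mul (oct_of_im x) (oct_of_im y)) 0 (rshift 1 k) =
    \sum_(i < 7) \sum_(j < 7) (eps_int i.+1 j.+1 k.+1)%:~R * (x 0 i * y 0 j).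
  rewrite /oct_mul summxE big_ord_recl.
  rewrite [X in X + _]summxE big1 ?add0r; last first.
    by move=> j _; rewrite mxE oct_of_im0 !mul0r.
  apply: eq_bigr => i _; rewrite summxE big_ord_recl mxE.
  rewrite oct_of_im0 mulr0 mul0r add0r.
  apply: eq_bigr => j _.
  rewrite mxE !oct_of_imS mulrC; congr (_ * _).
  rewrite /oct_mul_basis /=.
  rewrite mxE [X in X + _]mxE [X in - X + _]mxE /oct_e.
  rewrite [X in - (_ * X) + _]mxE /= mulr0 oppr0 add0r summxE.
  rewrite (bigD1 (rshift 1 k)) //= mxE mxE !eqxx mulr1 big1 ?addr0 ?epsE //.
  move=> l /andP[_ /negbTE nl]; rewrite mxE mxE eqxx /= eq_sym.
  by rewrite nl mulr0.
rewrite imE mxE imE.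
(* By antisymmetry of the structure constants the second product contributes
   minus the first. *)
rewrite [X in _ - X](_ : _ = - (\sum_(i < 7) \sum_(j < 7)
    (eps_int i.+1 j.+1 k.+1)%:~R * (u 0 i * v 0 j))).
  by rewrite opprK; lra.
rewrite exchange_big /= -sumrN; apply: eq_bigr => i _; rewrite -sumrN.
apply: eq_bigr => j _.
rewrite eps_int_swap; [|exact: (ltn_ord i)|exact: (ltn_ord j)|exact: (ltn_ord k)].
by rewrite mulrNz mulNr [v _ _ * _]mulrC.
Qed.

Ltac eval_eps :=
  repeat match goal with |- context [eps_int ?i ?j ?k] =>
    let v := eval vm_compute in (eps_int i j k) in
    change (eps_int i j k) with v
  end.

Lemma big_ord7 (V : nmodType) (F : 'I_7 -> V) :
  \sum_(i < 7) F i = F (inord 0) + F (inord 1) + F (inord 2) + F (inord 3)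
    + F (inord 4) + F (inord 5) + F (inord 6).
Proof.
rewrite 7!big_ord_recl big_ord0 addr0 !addrA.
by do ![congr (_ + _)]; congr F; apply/val_inj; rewrite /= inordK.
Qed.

Lemma forall_ord7 (P : 'I_7 -> Prop) : P (inord 0) -> P (inord 1) -> P (inord 2) ->
  P (inord 3) -> P (inord 4) -> P (inord 5) -> P (inord 6) -> forall i, P i.
Proof.
move=> P0 P1 P2 P3 P4 P5 P6 i; rewrite -(inord_val i).
by case: i => -[|[|[|[|[|[|[|//]]]]]]].
Qed.

(** Replaces the coordinates of [u] by variables, which [ring] compares much
    faster than matrix entries. *)
Ltac abstract_coords u :=
  generalize (u 0 (inord 0)) (u 0 (inord 1)) (u 0 (inord 2)) (u 0 (inord 3))
    (u 0 (inord 4)) (u 0 (inord 5)) (u 0 (inord 6)); do 7!move=> ?.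

Lemma cross_coords (R : realType) (u v : 'rV[R]_7) :
  let x (i : nat) := u 0 (inord i) in
  let y (i : nat) := v 0 (inord i) in
  (cross u v 0 (inord 0)
     = (x 1%N * y 2%N - x 2%N * y 1%N) + (x 3%N * y 4%N - x 4%N * y 3%N)
       + (x 5%N * y 6%N - x 6%N * y 5%N))
  * (cross u v 0 (inord 1)
     = (x 2%N * y 0%N - x 0%N * y 2%N) + (x 3%N * y 5%N - x 5%N * y 3%N)
       + (x 6%N * y 4%N - x 4%N * y 6%N))
  * (cross u v 0 (inord 2)
     = (x 0%N * y 1%N - x 1%N * y 0%N) + (x 6%N * y 3%N - x 3%N * y 6%N)
       + (x 5%N * y 4%N - x 4%N * y 5%N))
  * (cross u v 0 (inord 3)
     = (x 4%N * y 0%N - x 0%N * y 4%N) + (x 5%N * y 1%N - x 1%N * y 5%N)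
       + (x 2%N * y 6%N - x 6%N * y 2%N))
  * (cross u v 0 (inord 4)
     = (x 0%N * y 3%N - x 3%N * y 0%N) + (x 1%N * y 6%N - x 6%N * y 1%N)
       + (x 2%N * y 5%N - x 5%N * y 2%N))
  * (cross u v 0 (inord 5)
     = (x 6%N * y 0%N - x 0%N * y 6%N) + (x 1%N * y 3%N - x 3%N * y 1%N)
       + (x 4%N * y 2%N - x 2%N * y 4%N))
  * (cross u v 0 (inord 6)
     = (x 0%N * y 5%N - x 5%N * y 0%N) + (x 4%N * y 1%N - x 1%N * y 4%N)
       + (x 3%N * y 2%N - x 2%N * y 3%N)).
Proof.
move=> x y; do ![split];
  rewrite crossE !big_ord7 !inordK //= {}/x {}/y; eval_eps;
  abstract_coords u; abstract_coords v; ring.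
Qed.

(** * Algebra of the cross product *)

Lemma crossC (R : realType) (u v : 'rV[R]_7) : cross v u = - cross u v.
Proof. by rewrite /cross /im_of_oct -linearN -scalerN opprB. Qed.

Lemma dot_cross_cycle (R : realType) (u v w : 'rV[R]_7) :
  dot (cross u v) w = dot (cross v w) u.
Proof.
rewrite /dot !big_ord7 !cross_coords.
abstract_coords u; abstract_coords v; abstract_coords w; ring.
Qed.

(** For [x = y] this says cross x (cross x u) = <x, u> x - <x, x> u, the imaginary
    part of the alternative law x (x u) = (x x) u of the octonions; the general
    case is its polarization. *)
Lemma cross_cross (R : realType) (u x y : 'rV[R]_7) :
  cross (cross u x) y + cross (cross u y) x
    = dot u x *: y + dot u y *: x - (2 * dot x y) *: u.
Proof.
have coordinatewise (a b c d e : 'rV[R]_7) (r s t : R) :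
    (forall k, a 0 k + b 0 k = r * c 0 k + s * d 0 k - t * e 0 k) ->
    a + b = r *: c + s *: d - t *: e.
  by move=> abE; apply/rowP => k; rewrite !mxE.
apply: coordinatewise.
(* The inner products are replaced by variables with known coordinates, so that
   only the outer ones are expanded. *)
move: (cross_coords u x) (cross_coords u y).
move: (cross u x) (cross u y) => p q ps qs.
apply: forall_ord7; rewrite !cross_coords.
all: rewrite ?ps ?qs /dot !big_ord7 => {ps qs}.
all: abstract_coords u; abstract_coords x; abstract_coords y; ring.
Qed.

Lemma crossNl (R : realType) (u v : 'rV[R]_7) : cross (- u) v = - cross u v.
Proof.
apply/rowP => k; rewrite crossE mxE crossE -sumrN.
apply: eq_bigr => i _; rewrite -sumrN; apply: eq_bigr => j _.
by rewrite mxE mulNr mulrN.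
Qed.

Lemma dotE (R : realType) n (u v : 'rV[R]_n) : dot u v = (u *m v^T) 0 0.
Proof. by rewrite mxE; apply: eq_bigr => i _; rewrite mxE. Qed.

Lemma dotC (R : realType) n (u v : 'rV[R]_n) : dot u v = dot v u.
Proof. by apply: eq_bigr => i _; rewrite mulrC. Qed.

Lemma dotDl (R : realType) n (u v w : 'rV[R]_n) : dot (u + v) w = dot u w + dot v w.
Proof. by rewrite !dotE mulmxDl mxE. Qed.

Lemma dotNl (R : realType) n (u w : 'rV[R]_n) : dot (- u) w = - dot u w.
Proof. by rewrite !dotE mulNmx mxE. Qed.

Lemma dot0l (R : realType) n (w : 'rV[R]_n) : dot 0 w = 0.
Proof. by rewrite dotE mul0mx mxE. Qed.

Lemma dotZl (R : realType) n c (u w : 'rV[R]_n) : dot (c *: u) w = c * dot u w.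
Proof. by rewrite !dotE -scalemxAl mxE. Qed.

Lemma dot_gt0 (R : realType) n (u : 'rV[R]_n) : u != 0 -> 0 < dot u u.
Proof.
move=> /rV0Pn[i ui]; rewrite /dot (bigD1 i) //= ltr_pwDl //.
  by rewrite -expr2 lt0r sqr_ge0 sqrf_eq0 ui.
by apply: sumr_ge0 => j _; rewrite -expr2 sqr_ge0.
Qed.

Lemma dot_mulmx_col (R : realType) n m (v : 'rV[R]_n) (a : 'I_m -> 'rV[R]_n) i :
  (v *m \matrix_(j, k) a k 0 j) 0 i = dot (a i) v.
Proof. by rewrite mxE; apply: eq_bigr => j _; rewrite mxE mulrC. Qed.

Lemma exists_orthogonal (R : realType) n m (a : 'I_m -> 'rV[R]_n) : (m < n)%N ->
  exists2 v : 'rV[R]_n, v != 0 & forall i, dot (a i) v = 0.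
Proof.
move=> ltmn; pose A : 'M[R]_(n, m) := \matrix_(j, k) a k 0 j.
have : kermx A != 0.
  rewrite kermx_eq0 /row_free neq_ltn; apply/orP; left.
  exact: leq_ltn_trans (rank_leq_col A) ltmn.
case/rowV0Pn => v /sub_kermxP vA v0; exists v => // i.
by rewrite -dot_mulmx_col vA mxE.
Qed.

Lemma dot_cross_self (R : realType) (p x : 'rV[R]_7) : dot p (cross p x) = 0.
Proof.
have : dot (cross p x) p = - dot (cross p x) p.
  by rewrite {1}dot_cross_cycle crossC dotNl.
rewrite dotC; lra.
Qed.

Lemma cross_crossr (R : realType) (p x : 'rV[R]_7) : dot p x = 0 ->
  cross x (cross p x) = dot x x *: p.
Proof.
move=> px; have := cross_cross p x x; rewrite px scale0r !addr0 sub0r => xpx.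
rewrite crossC; apply: (@scalerI _ _ 2) => //.
by rewrite scalerN [X in - X]scaler_nat [X in - X]mulr2n xpx opprK scalerA.
Qed.

Lemma crossvv (R : realType) (p : 'rV[R]_7) : cross p p = 0.
Proof. by rewrite /cross subrr scaler0 /im_of_oct linear0. Qed.

Lemma cross0l (R : realType) (v : 'rV[R]_7) : cross 0 v = 0.
Proof.
apply/rowP => k; rewrite crossE mxE big1 // => i _; rewrite big1 // => j _.
by rewrite mxE mul0r mulr0.
Qed.

(** On the tangent space of the unit sphere at [p], the map [cross p] is an
    almost complex structure. *)
Lemma cross_crossl (R : realType) (p y : 'rV[R]_7) : dot p p = 1 -> dot p y = 0 ->
  cross p (cross p y) = - y.
Proof.
move=> pp py; have := cross_cross p p y.
rewrite crossvv cross0l pp py scale1r scale0r mulr0 scale0r subr0 addr0 add0r.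
by move=> ppy; rewrite crossC ppy.
Qed.

(** * The pointwise obstruction *)

(** If [B x m] is the second derivative of a parametrization of the sphere along
    the coordinate fields that extend the tangent vectors [x] and [m] at [p], then
    its component along [p] is forced by the sphere, and constancy of the
    coefficients of the form gives the last, quantified, equation.  Write
    [a = cross p x] and [b = cross p y] for [x], [y] complex orthogonal.  In the
    sum of the equations for (x, z, w, m) equal to (x, a, y, y), (x, a, b, b),
    (y, b, x, x) and (y, b, a, a), the terms with B x y, B a y, B x b and B a b
    cancel because cross a y + cross b x = 0 and cross a b = cross y x.  The four
    remaining terms are omega(x, a, B m m) = |x|^2 <p, B m m> = - |x|^2 |m|^2 for
    m = y, b, and the same with (x, a) and (y, b) exchanged; they add up to
    - 4 |x|^2 |y|^2. *)
Lemma no_symmetric_second_derivative (R : realType) (p : 'rV[R]_7)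
    (B : 'rV[R]_7 -> 'rV[R]_7 -> 'rV[R]_7) :
  dot p p = 1 ->
  (forall x m, B x m = B m x) ->
  (forall x m, dot p x = 0 -> dot p m = 0 -> dot p (B x m) = - dot x m) ->
  ~ (forall x z w m, dot p x = 0 -> dot p z = 0 -> dot p w = 0 -> dot p m = 0 ->
     omega_tilde (B x m) z w + omega_tilde x (B z m) w + omega_tilde x z (B w m) = 0).
Proof.
move=> pp Bsym Bp Bw.
have [x x0 xP] := @exists_orthogonal R 7 1 (fun=> p) isT.
have {xP} px : dot p x = 0 := xP 0.
pose a := cross p x.
have pa : dot p a = 0 by exact: dot_cross_self.
have [y y0 yP] := @exists_orthogonal R 7 3 (fun i => [:: p; x; a]`_i) isT.
have py : dot p y = 0 := yP 0.
have xy : dot x y = 0 := yP 1.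
have {yP} ay : dot a y = 0 := yP (@Ordinal 3 2 isT).
pose b := cross p y.
have pb : dot p b = 0 by exact: dot_cross_self.
have xb : dot x b = 0.
  by rewrite dotC /b dot_cross_cycle dot_cross_cycle crossC dotNl -/a ay oppr0.
have pb_y : cross p b = - y by exact: cross_crossl.
have ay_bx : cross a y + cross b x = 0.
  by rewrite cross_cross px py xy mulr0 !scale0r subr0 addr0.
have ab : cross a b = cross y x.
  have := cross_cross p x b.
  rewrite px pb xb mulr0 !scale0r subr0 addr0 -/a pb_y crossNl.
  by move/eqP; rewrite subr_eq0 => /eqP.
have aa : dot a a = dot x x.
  by rewrite {1}/a dot_cross_cycle cross_crossr // dotZl pp mulr1.
have bb : dot b b = dot y y.
  by rewrite {1}/b dot_cross_cycle cross_crossr // dotZl pp mulr1.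
(* The terms that do not cancel. *)
have xa u v : dot p u = 0 -> dot p v = 0 ->
    omega_tilde x a (B u v) = - (dot x x * dot u v).
  by move=> pu pv; rewrite /omega_tilde cross_crossr // dotZl Bp // mulrN.
have yb u v : dot p u = 0 -> dot p v = 0 ->
    omega_tilde y b (B u v) = - (dot y y * dot u v).
  by move=> pu pv; rewrite /omega_tilde cross_crossr // dotZl Bp // mulrN.
have := Bw x a y y px pa py py.
have := Bw x a b b px pa pb pb.
have := Bw y b x x py pb px px.
have := Bw y b a a py pb pa pa.
(* Every other term becomes a scalar product of a value of [B] with a cross
   product. *)
have Bl u v z w : omega_tilde (B u v) z w = dot (cross z w) (B u v).
  by rewrite /omega_tilde dot_cross_cycle.
have Bm u v z w : omega_tilde z (B u v) w = dot (cross w z) (B u v).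
  by rewrite /omega_tilde dot_cross_cycle dot_cross_cycle.
rewrite !xa // !yb // !Bl !Bm aa bb.
rewrite (Bsym y x) (Bsym y a) (Bsym b x) (Bsym b a) ab (crossC a b) ab.
move: (congr1 (fun v => dot v (B x y)) ay_bx) (congr1 (fun v => dot v (B a b)) ay_bx).
rewrite /= !dotDl (crossC x y) !dotNl !dot0l.
rewrite !(mulrC (dot y y)).
have := mulr_gt0 (dot_gt0 x0) (dot_gt0 y0).
move: (_ * _) => k.
generalize (dot (cross a y) (B x y)) (dot (cross b x) (B x y))
  (dot (cross a y) (B a b)) (dot (cross b x) (B a b))
  (dot (cross x y) (B a y)) (dot (cross x y) (B x b)).
move=> s1 s2 s3 s4 s5 s6 k0 H1 H2 H3 H4 H5 H6.
clear -k0 H1 H2 H3 H4 H5 H6; lra.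
Qed.

(** * Symmetry of second derivatives *)

Lemma is_derive_line (R : realType) (V W : normedModType R) (f : V -> W) (df : W)
    (a X : V) (s : R) :
  is_derive (a + s *: X) X f df -> is_derive s 1 (fun t : R => f (a + t *: X)) df.
Proof.
have quotientE : (fun h : R => h^-1 *:
      (((fun t : R => f (a + t *: X)) \o shift s) (h *: (1 : R^o))
       - f (a + s *: X))) =
    (fun h => h^-1 *: ((f \o shift (a + s *: X)) (h *: X) - f (a + s *: X))).
  apply/funext => h /=; rewrite (_ : h *: (1 : R^o) = h); last exact: mulr1.
  by rewrite scalerDl addrCA.
by case=> fd <-; split; rewrite /derivable /derive quotientE.
Qed.

Lemma is_derive_translate (R : realType) (V W : normedModType R) (f : V -> W) (df : W)
    (a c X : V) :
  is_derive (a + c) X f df -> is_derive a X (fun z => f (z + c)) df.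
Proof.
have quotientE : (fun h : R =>
      h^-1 *: (((fun z => f (z + c)) \o shift a) (h *: X) - f (a + c))) =
    (fun h => h^-1 *: ((f \o shift (a + c)) (h *: X) - f (a + c))).
  by apply/funext => h /=; rewrite addrA.
by case=> fd <-; split; rewrite /derivable /derive quotientE.
Qed.

Lemma mean_value_line (R : realType) (V : normedModType R) (f df : V -> R)
    (a X : V) (t : R) : 0 < t ->
  (forall s, 0 <= s <= t -> is_derive (a + s *: X) X f (df (a + s *: X))) ->
  exists2 s, 0 <= s <= t & f (a + t *: X) - f a = t * df (a + s *: X).
Proof.
move=> t0 fX; pose g (s : R) := f (a + s *: X).
have gP s : 0 <= s <= t -> is_derive s 1 g (df (a + s *: X)).
  by move=> /fX; exact: is_derive_line.
have [|| s + e] := @MVT R g (fun s => df (a + s *: X)) 0 t t0.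
- by move=> s; rewrite in_itv /= => /andP[s0 st]; apply: gP; rewrite !ltW.
- by apply: derivable_within_continuous => s; rewrite in_itv /= => /gP[].
rewrite in_itv /= => /andP[s0 st]; move: e; rewrite /g scale0r addr0 subr0 mulrC => e.
by exists s; rewrite ?ltW.
Qed.

(** The mean value theorem, applied along [X] to the increment of [f] in the
    direction [Y], then along [Y] to [fX]. *)
Lemma second_difference (R : realType) (V : normedModType R) (f fX fXY : V -> R)
    (q X Y : V) (t : R) : 0 < t ->
  (forall s r, 0 <= s <= t -> 0 <= r <= t ->
     let z := q + s *: X + r *: Y in
     is_derive z X f (fX z) /\ is_derive z Y fX (fXY z)) ->
  exists s r, [/\ 0 <= s <= t, 0 <= r <= t &
    f (q + t *: X + t *: Y) - f (q + t *: X) - f (q + t *: Y) + f q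
    = t * t * fXY (q + s *: X + r *: Y)].
Proof.
move=> t0 fP.
have tt : 0 <= t <= t by rewrite lexx ltW.
have t00 : 0 <= (0 : R) <= t by rewrite lexx ltW.
pose h z := f (z + t *: Y) - f z.
have [s sP eX] : exists2 s, 0 <= s <= t &
    h (q + t *: X) - h q = t * (fX (q + s *: X + t *: Y) - fX (q + s *: X)).
  apply: (@mean_value_line _ _ h (fun z => fX (z + t *: Y) - fX z)) => // s sP.
  have [d1 _] := fP s t sP tt; have [d2 _] := fP s 0 sP t00.
  rewrite scale0r addr0 in d2.
  (* [is_deriveB] finds the derivative of the unshifted term in [d2]. *)
  apply: is_deriveB.
  exact: is_derive_translate.
have [r rP eY] : exists2 r, 0 <= r <= t &
    fX (q + s *: X + t *: Y) - fX (q + s *: X) = t * fXY (q + s *: X + r *: Y).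
  by apply: mean_value_line => // r rP; have [] := fP s r sP rP.
exists s, r; split => //.
by rewrite -mulrA -eY -eX /h; ring.
Qed.

Lemma near_parallelogram (R : realType) (V : normedModType R) (q X Y : V) (P : set V) :
  nbhs q P -> exists2 t : R, 0 < t &
    forall s r, 0 <= s <= t -> 0 <= r <= t -> P (q + s *: X + r *: Y).
Proof.
move=> /nbhs_ballP[e /= e0 eP].
have d0 : 0 < `|X| + `|Y| + 1 by rewrite ltr_wpDl // addr_ge0.
exists (e / (`|X| + `|Y| + 1)); first exact: divr_gt0.
set t := e / _ => s r /andP[s0 st] /andP[r0 rt]; apply: eP.
rewrite -ball_normE /= -addrA opprD addNKr normrN.
apply: (le_lt_trans (ler_normD _ _)); rewrite !normrZ !ger0_norm //.
apply: (@le_lt_trans _ _ (t * (`|X| + `|Y|))).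
  by rewrite mulrDr lerD // ler_wpM2r.
by rewrite /t mulrAC ltr_pdivrMr // ltr_pM2l // ltrDl.
Qed.

(** The second difference of [f] over a small parallelogram is symmetric in the
    two directions and is, up to the factor t^2, a value of either mixed
    derivative at a point close to [q]. *)
Lemma mixed_derivatives_eq (R : realType) (V : normedModType R)
    (f fX fY fXY fYX : V -> R) (q X Y : V) :
  (\forall z \near q, is_derive z X f (fX z)) ->
  (\forall z \near q, is_derive z Y f (fY z)) ->
  (\forall z \near q, is_derive z Y fX (fXY z)) ->
  (\forall z \near q, is_derive z X fY (fYX z)) ->
  {for q, continuous fXY} -> {for q, continuous fYX} -> fXY q = fYX q.
Proof.
move=> dX dY dXY dYX cXY cYX; apply/eqP; rewrite -subr_eq0 -normr_le0.
apply/ler_addgt0Pr => e e0; rewrite add0r.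
have e20 : 0 < e / 2 by rewrite divr_gt0.
have nXY : \forall z \near q, `|fXY q - fXY z| < e / 2.
  by move/cvgrPdist_lt : cXY; apply.
have nYX : \forall z \near q, `|fYX q - fYX z| < e / 2.
  by move/cvgrPdist_lt : cYX; apply.
have [t t0 tP] := @near_parallelogram _ _ q X Y _
  (filterI (filterI (filterI dX dY) (filterI dXY dYX)) (filterI nXY nYX)).
have [s [r [sP rP diffXY]]] : exists s r, [/\ 0 <= s <= t, 0 <= r <= t &
    f (q + t *: X + t *: Y) - f (q + t *: X) - f (q + t *: Y) + f q
    = t * t * fXY (q + s *: X + r *: Y)].
  by apply: (@second_difference _ _ f fX) => // s r sP rP /=;
     have [[[? ?] [? ?]] _] := tP s r sP rP.
have [s' [r' [s'P r'P diffYX]]] : exists s r, [/\ 0 <= s <= t, 0 <= r <= t &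
    f (q + t *: Y + t *: X) - f (q + t *: Y) - f (q + t *: X) + f q
    = t * t * fYX (q + s *: Y + r *: X)].
  apply: (@second_difference _ _ f fY) => // s' r' s'P r'P /=.
  by rewrite addrAC; have [[[? ?] [? ?]] _] := tP r' s' r'P s'P.
have : fXY (q + s *: X + r *: Y) = fYX (q + r' *: X + s' *: Y).
  apply: (@mulfI _ (t * t)); first by rewrite mulf_neq0 ?gt_eqF.
  by rewrite -diffXY -[q + r' *: X + _]addrAC -diffYX [q + t *: Y + _]addrAC; ring.
have [_ [+ _]] := tP s r sP rP; have [_ [_ +]] := tP r' s' r'P s'P.
move=> + + mixedE; rewrite mixedE !ltr_norml ler_norml; lra.
Qed.

(** * Derivatives of vector-valued maps *)

Lemma is_derive_sumfun (R : realType) (V W : normedModType R) n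
    (h : 'I_n -> V -> W) (dh : 'I_n -> W) (q X : V) :
  (forall i, is_derive q X (h i) (dh i)) ->
  is_derive q X (fun z => \sum_(i < n) h i z) (\sum_(i < n) dh i).
Proof.
by move=> dhP; rewrite -fct_sumE; exact: is_derive_sum.
Qed.

Lemma is_derive_mulfun (R : realType) (V : normedModType R) (f g : V -> R) (df dg : R)
    (q X : V) :
  is_derive q X f df -> is_derive q X g dg ->
  is_derive q X (fun z => f z * g z) (df * g q + f q * dg).
Proof.
move=> dfP dgP; rewrite addrC (mulrC df).
exact: is_deriveM.
Qed.

Lemma is_derive_coordP (R : realType) (V : normedModType R) n
    (f : V -> 'rV[R]_n) df (q X : V) :
  is_derive q X f df <-> forall i, is_derive q X (fun z => f z 0 i) (df 0 i).
Proof.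
split=> [[fd <-] i|dfP].
  split; first by move/derivable_mxP : fd; apply.
  by rewrite derive_mx // mxE.
have fd : derivable f q X.
  by apply/derivable_mxP => i j; rewrite (ord1 i); case: (dfP j).
split => //; apply/rowP => j; rewrite derive_mx // mxE.
by case: (dfP j).
Qed.

Lemma is_derive_dot (R : realType) (V : normedModType R) n
    (f g : V -> 'rV[R]_n) df dg (q X : V) :
  is_derive q X f df -> is_derive q X g dg ->
  is_derive q X (fun z => dot (f z) (g z)) (dot df (g q) + dot (f q) dg).
Proof.
move=> /is_derive_coordP dfP /is_derive_coordP dgP.
rewrite /dot -big_split /=; apply: is_derive_sumfun => i.
exact: is_derive_mulfun.
Qed.

Lemma is_derive_cross (R : realType) (V : normedModType R)
    (f g : V -> 'rV[R]_7) df dg (q X : V) :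
  is_derive q X f df -> is_derive q X g dg ->
  is_derive q X (fun z => cross (f z) (g z)) (cross df (g q) + cross (f q) dg).
Proof.
move=> /is_derive_coordP dfP /is_derive_coordP dgP.
apply/is_derive_coordP => k.
rewrite [X in is_derive _ _ _ X]mxE !crossE -big_split /=.
under eq_fun do rewrite crossE.
apply: is_derive_sumfun => i; rewrite -big_split /=.
apply: is_derive_sumfun => j; rewrite -mulrDr.
set c := _%:~R.
apply: is_derive_eq (is_derive_mulfun (is_derive_cst c q X)
  (is_derive_mulfun (dfP i) (dgP j))) _.
by rewrite mul0r add0r.
Qed.

Lemma is_derive_omega_tilde (R : realType) (V : normedModType R) (f g h : V -> 'rV[R]_7)
    df dg dh (q X : V) :
  is_derive q X f df -> is_derive q X g dg -> is_derive q X h dh ->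
  is_derive q X (fun z => omega_tilde (f z) (g z) (h z))
    (omega_tilde df (g q) (h q) + omega_tilde (f q) dg (h q)
     + omega_tilde (f q) (g q) dh).
Proof.
move=> dfP dgP dhP; have := is_derive_dot (is_derive_cross dfP dgP) dhP.
by rewrite dotDl.
Qed.

Lemma smooth_is_derive (R : realType) (V W : normedModType R) (A : set V)
    (f : V -> W) X z :
  smooth A f -> A z -> is_derive z X f ('D_X f z).
Proof.
by move=> fs Az; apply: derivableP; apply: diff_derivable; have [+ _] := fs 1%N; apply.
Qed.

Lemma smooth_derive (R : realType) (V W : normedModType R) (A : set V)
    (f : V -> W) X :
  smooth A f -> smooth A ('D_X f).
Proof. by move=> fs k; have [_ +] := fs k.+1; apply. Qed.

Lemma smooth_continuous (R : realType) (V W : normedModType R) (A : set V)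
    (f : V -> W) z :
  smooth A f -> A z -> {for z, continuous f}.
Proof. by move=> fs; exact: (fs 0%N). Qed.

Lemma derive_derive_sym (R : realType) (V : normedModType R) n (A : set V)
    (f : V -> 'rV[R]_n) X Y q : open A -> smooth A f -> A q ->
  'D_Y ('D_X f) q = 'D_X ('D_Y f) q.
Proof.
move=> oA fs Aq.
have nA : \forall z \near q, A z by exact: open_nbhs_nbhs.
have coordP (g : V -> 'rV[R]_n) Z i z : smooth A g -> A z ->
    is_derive z Z (fun z => g z 0 i) ('D_Z g z 0 i).
  by move=> gs Az; move: i; apply/is_derive_coordP; exact: smooth_is_derive gs Az.
have contP (g : V -> 'rV[R]_n) i : smooth A g -> {for q, continuous (fun z => g z 0 i)}.
  move=> gs; apply: (@continuous_comp _ _ _ g (fun u : 'rV[R]_n => u 0 i)).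
    exact: smooth_continuous gs Aq.
  exact: coord_continuous.
apply/rowP => i.
apply: (@mixed_derivatives_eq _ _ (fun z => f z 0 i) (fun z => 'D_X f z 0 i)
   (fun z => 'D_Y f z 0 i) (fun z => 'D_Y ('D_X f) z 0 i)
   (fun z => 'D_X ('D_Y f) z 0 i) q X Y).
- by apply: filterS nA => z; exact: coordP.
- by apply: filterS nA => z; exact: coordP.
- by apply: filterS nA => z; apply: coordP; exact: smooth_derive.
- by apply: filterS nA => z; apply: coordP; exact: smooth_derive.
- by apply: contP; do 2!apply: smooth_derive.
- by apply: contP; do 2!apply: smooth_derive.
Qed.

(** * Charts of the sphere *)

Definition inverse_chart (R : realType) (n : nat) (U : set 'rV[R]_n.+1)
    (u : 'rV[R]_n.+1 -> 'rV[R]_n) (phi : 'rV[R]_n -> 'rV[R]_n.+1) : Prop :=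
  [/\ U `<=` @sphere R n, open (u @` U), smooth_on U u,
      smooth (u @` U) phi & forall x, U x -> phi (u x) = x].

(** Whichever local extension [g] of [u] is used to compute the differential of
    [u], it is a left inverse of [phi], and the chain rule applies to the
    identity [g \o phi]. *)
Lemma diff_on_parametrization (R : realType) (n : nat) (U : set 'rV[R]_n.+1)
    (u : 'rV[R]_n.+1 -> 'rV[R]_n) (phi : 'rV[R]_n -> 'rV[R]_n.+1) x X :
  inverse_chart U u phi -> U x ->
  diff_on U u x ('D_X phi (u x)) = X.
Proof.
move=> [_ openV smooth_u smooth_phi phiK] Ux.
have Vx : (u @` U) (u x) by exists x.
have [A [oA Ax gs gu]] := xgetPex u (smooth_u x Ux).
rewrite /diff_on; move: gs gu; set g := xget _ _ => gs gu.
have dphi : differentiable phi (u x) by have [+ _] := smooth_phi 1%N; apply.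
have dg : differentiable g (phi (u x)).
  by rewrite phiK //; have [+ _] := gs 1%N; apply.
have near_id : \forall y \near u x, g (phi y) = y.
  have nV : \forall y \near u x, (u @` U) y by exact: open_nbhs_nbhs.
  have nA : \forall y \near u x, A (phi y).
    apply: (smooth_continuous smooth_phi Vx).
    by rewrite phiK //; exact: open_nbhs_nbhs.
  by apply: filterS2 nV nA => _ [z Uz <-]; rewrite phiK // => Az; exact: gu.
have : 'D_X (g \o phi) (u x) = X by rewrite (near_eq_derive X near_id) derive_id.
rewrite deriveE; last exact: differentiable_comp.
by rewrite diff_comp //= phiK // deriveE.
Qed.

Lemma tangent_parametrization (R : realType) (n : nat) (U : set 'rV[R]_n.+1)
    (u : 'rV[R]_n.+1 -> 'rV[R]_n) (phi : 'rV[R]_n -> 'rV[R]_n.+1) y X :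
  inverse_chart U u phi -> (u @` U) y -> dot (phi y) ('D_X phi y) = 0.
Proof.
move=> [U_sphere openV _ smooth_phi phiK] Vy.
have dP := smooth_is_derive X smooth_phi Vy.
have [_] := is_derive_dot dP dP.
rewrite (_ : 'D_X _ y = 0).
  by rewrite dotC; lra.
rewrite -(derive_cst (1 : R) y X); apply: near_eq_derive.
have nV : \forall z \near y, (u @` U) z by exact: open_nbhs_nbhs.
by apply: filterS nV => _ [z Uz <-]; rewrite phiK //; exact: U_sphere.
Qed.

(** The differential of [phi] is injective, since it has a left inverse, so by
    dimension its image is the whole tangent space. *)
Lemma tangent_parametrization_surj (R : realType) (n : nat) (U : set 'rV[R]_n.+1)
    (u : 'rV[R]_n.+1 -> 'rV[R]_n) (phi : 'rV[R]_n -> 'rV[R]_n.+1) x w :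
  inverse_chart U u phi -> U x ->
  dot x w = 0 -> exists X, w = 'D_X phi (u x).
Proof.
move=> chart Ux xw; have [U_sphere openV _ smooth_phi phiK] := chart.
have Vx : (u @` U) (u x) by exists x.
have dphi : differentiable phi (u x) by have [+ _] := smooth_phi 1%N; apply.
pose M := jacobian phi (u x).
have DM X : 'D_X phi (u x) = X *m M by exact: deriveEjacobian.
have freeM : row_free M.
  rewrite -kermx_eq0; apply/rowV0P => X /sub_kermxP XM.
  rewrite -(diff_on_parametrization X chart Ux) DM XM -(mul0mx _ M) -DM.
  exact: diff_on_parametrization.
have MK : (M <= kermx x^T)%MS.
  apply/rV_subP => _ /submxP[X ->]; apply/sub_kermxP/rowP => i.
  rewrite (ord1 i) -DM -dotE dotC mxE -{1}(phiK x Ux).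
  exact: tangent_parametrization chart Vx.
have x0 : x != 0.
  apply/eqP => x0; have := U_sphere x Ux; rewrite /sphere /= x0 dot0l.
  by move/esym/eqP; rewrite oner_eq0.
have : (kermx x^T <= M)%MS.
  rewrite -(geq_leqif (mxrank_leqif_sup MK)) mxrank_ker mxrank_tr rank_rV x0 subn1 /=.
  by rewrite (eqP freeM).
have : (w <= kermx x^T)%MS.
  apply/sub_kermxP/rowP => i.
  by rewrite (ord1 i) -dotE dotC xw mxE.
move=> wK /(submx_trans wK)/submxP[X ->]; exists X; exact/esym/DM.
Qed.

(** * The theorem *)

Theorem theorem2p15 (R : realType) :
  ~ (exists p : 'rV[R]_7,
       sphere p /\ has_darboux_coordinates_near (@omega R) p).
Proof.
move=> [p [_ [U [u [a [Up [[A oA UA] oV su [phi sphi phiK]] darboux]]]]]].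
have chart : inverse_chart U u phi by split=> // x; rewrite UA => -[].
have Vq : (u @` U) (u p) by exists p.
(* On the fields D_X phi, D_Y phi, D_Z phi the coordinate differentials take the
   coordinates of X, Y, Z as values, at every point. *)
have const X Y Z : exists c, forall y, (u @` U) y ->
    omega_tilde ('D_X phi y) ('D_Y phi y) ('D_Z phi y) = c.
  pose W (c : 'I_3) := [:: X; Y; Z]`_c.
  exists (\sum_(I : {ffun 'I_3 -> 'I_6} | strictly_increasing I)
    a I * \det (\matrix_(b < 3, c < 3) W c 0 (I b))).
  move=> _ [x Ux <-].
  have := darboux x (fun c => 'D_(W c) phi (u x)) Ux.
  rewrite /omega /= => -> // => [|c]; last first.
    rewrite /tangent_sphere /= -[X in dot X _](phiK x Ux).
    by apply: (tangent_parametrization _ chart); exists x.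
  apply: eq_bigr => I _; congr (_ * \det _).
  by apply/matrixP => b c; rewrite !mxE diff_on_parametrization.
(* Tangent vectors at [p] are extended to coordinate fields, so that the second
   derivatives of [phi] become a map on tangent vectors. *)
pose lift w := xget 0 [set X | w = 'D_X phi (u p)].
have liftP w : dot p w = 0 -> 'D_(lift w) phi (u p) = w.
  by move=> pw; exact/esym/(xgetPex 0 (tangent_parametrization_surj chart Up pw)).
pose B x m := 'D_(lift m) ('D_(lift x) phi) (u p).
have dphi X : is_derive (u p) X phi ('D_X phi (u p)) by exact: smooth_is_derive sphi _.
have ddphi X Y : is_derive (u p) Y ('D_X phi) ('D_Y ('D_X phi) (u p)).
  by apply: smooth_is_derive Vq; exact: smooth_derive.
have derive_cst_near (f : 'rV[R]_6 -> R) c X : (forall y, (u @` U) y -> f y = c) ->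
    'D_X f (u p) = 0.
  move=> fc; rewrite -(derive_cst c (u p) X); apply: near_eq_derive.
  by apply: filterS (open_nbhs_nbhs (conj oV Vq)).
apply: (@no_symmetric_second_derivative R p B).
- by have [US _ _ _ _] := chart; exact: US.
- by move=> x m; exact: derive_derive_sym oV sphi Vq.
- move=> x m px pm.
  have [_] := is_derive_dot (dphi (lift m)) (ddphi (lift x) (lift m)).
  rewrite (derive_cst_near _ 0); last first.
    by move=> y; exact: tangent_parametrization chart.
  by rewrite !liftP // phiK // dotC -/(B x m); lra.
- move=> x z w m px pz pw pm.
  have [c cP] := const (lift x) (lift z) (lift w).
  have [_] := is_derive_omega_tilde (ddphi (lift x) (lift m))
    (ddphi (lift z) (lift m)) (ddphi (lift w) (lift m)).
  by rewrite (derive_cst_near _ c) // !liftP.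
Qed.
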